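(* Let $\mathbf{A}\in\mathbb{R}^{m\times n}$ be nonzero and $b\in\mathbb{R}^m$ be such that the linear system $\mathbf{A}x=b$ is consistent, with solution set $\mathcal{L}=\{x\in\mathbb{R}^n:\mathbf{A}x=b\}$. Let $\mathcal{D}$ be a distribution over random matrices $\mathbf{S}$ (with $m$ rows), and consider the stochastic optimization reformulation $\min_{x\in\mathbb{R}^n}f(x):=\mathbb{E}_{\mathbf{S}\sim\mathcal{D}}[f_{\mathbf{S}}(x)]$ of the linear system, whose set of minimizers is $\mathcal{X}^*=\mathcal{L}$. Let $x^*$ be the Euclidean projection of $x^0$ onto $\mathcal{X}^*=\mathcal{L}$. Then SGD with SPS with $c=1/2$ applied to this reformulation satisfies, for all $k\ge0$, $$\mathbb{E}\|x^{k}-x^*\|^2\le\left(1-\lambda_{\min}^+(\mathbf{W})\right)^k\|x^0-x^*\|^2,$$ where $\lambda_{\min}^+(\mathbf{W})$ is the smallest nonzero eigenvalue of $\mathbf{W}=\mathbb{E}_{\mathbf{S}\sim\mathcal{D}}[\mathbf{A}^\top\mathbf{H}\mathbf{A}]$.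
   Context: For a random matrix $\mathbf{S}\sim\mathcal{D}$ define $\mathbf{H}:=\mathbf{S}(\mathbf{S}^\top\mathbf{A}\mathbf{A}^\top\mathbf{S})^\dagger\mathbf{S}^\top$, where $\dagger$ is the Moore-Penrose pseudoinverse, and $$f_{\mathbf{S}}(x):=\tfrac12(\mathbf{A}x-b)^\top\mathbf{H}(\mathbf{A}x-b).$$ It is a standing assumption on the reformulation (i.e. on $\mathcal{D}$) that it is equivalent to the linear system: the set $\mathcal{X}^*$ of minimizers of $f$ equals $\mathcal{L}$. SGD: starting from a deterministic $x^0\in\mathbb{R}^n$, at each iteration $k$ a matrix $\mathbf{S}_k\sim\mathcal{D}$ is drawn independently of the past, and $x^{k+1}=x^k-\gamma_k\nabla f_{\mathbf{S}_k}(x^k)$. SPS with $c=1/2$: $\gamma_k=\frac{2\left[f_{\mathbf{S}_k}(x^k)-f_{\mathbf{S}_k}^*\right]}{\|\nabla f_{\mathbf{S}_k}(x^k)\|^2}$, where $f_{\mathbf{S}}^*=\inf_xf_{\mathbf{S}}(x)=0$. If $\nabla f_{\mathbf{S}_k}(x^k)=0$ then $x^{k+1}=x^k$. *)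

(* Defs.v *)
From HB Require Import structures.
From mathcomp Require Import all_boot all_order all_algebra finmap.
From mathcomp Require Import all_classical all_reals all_analysis.

Set Implicit Arguments.
Unset Strict Implicit.
Unset Printing Implicit Defensive.

Import Order.TTheory GRing.Theory Num.Theory.
Import numFieldNormedType.Exports.

Local Open Scope classical_set_scope.
Local Open Scope ring_scope.

Definition enorm (R : realType) (n : nat) (x : 'cV[R]_n) : R :=
  Num.sqrt (\sum_i x i 0 ^+ 2).

Definition gradient (R : realType) (n : nat) (g : 'cV[R]_n -> R) (x : 'cV[R]_n) :
    'cV[R]_n :=
  \col_i 'D_(delta_mx i 0) g x.

Definition penrose (R : realType) (p q : nat) (M : 'M[R]_(p, q)) (X : 'M[R]_(q, p)) :
    Prop :=
  [/\ M *m X *m M = M, X *m M *m X = X,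
      (M *m X)^T = M *m X & (X *m M)^T = X *m M].

(* Existence and uniqueness of the value selected here are pinvP and penrose_uniq
   below; the library's pinvmx satisfies only some of the Penrose equations. *)
Definition pinv (R : realType) (p q : nat) (M : 'M[R]_(p, q)) : 'M[R]_(q, p) :=
  xget 0 [set X | penrose M X].

Lemma row_gram_unit (R : realType) (p q : nat) (B : 'M[R]_(p, q)) :
  row_free B -> B *m B^T \in unitmx.
Proof.
move=> Bfree; rewrite -row_free_unit -kermx_eq0; apply/eqP/row_matrixP => i.
rewrite row0; set v := row i _.
have vBB : v *m (B *m B^T) = 0 by rewrite /v -row_mul mulmx_ker row0.
have vB0 : v *m B = 0.
  have : (v *m B *m (v *m B)^T) 0 0 = 0.
    by rewrite trmx_mul mulmxA -[v *m B *m _]mulmxA vBB mul0mx mxE.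
  rewrite mxE => /eqP; rewrite psumr_eq0; last first.
    by move=> j _; rewrite [X in _ * X]mxE -expr2 sqr_ge0.
  move/allP => h; apply/rowP => j; have /= := h j (mem_index_enum _).
  by rewrite [X in _ * X]mxE -expr2 sqrf_eq0 => /eqP ->; rewrite mxE.
by apply: (row_free_inj Bfree); rewrite vB0 mul0mx.
Qed.

Lemma pinvP (R : realType) (p q : nat) (M : 'M[R]_(p, q)) : penrose M (pinv M).
Proof.
suff [X hX] : exists X, penrose M X by exact: (xgetPex 0 (ex_intro _ X hX)).
have Bu := row_gram_unit (row_base_free M).
have Cu : (col_base M)^T *m col_base M \in unitmx.
  rewrite -[X in _ *m X]trmxK; apply: row_gram_unit.
  by rewrite /row_free mxrank_tr; have := col_base_full M.
have := mulmx_base M; move: (col_base M) (row_base M) Bu Cu => C B Bu Cu <-.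
exists (B^T *m invmx (B *m B^T) *m (invmx (C^T *m C) *m C^T)).
have CX : C *m B *m (B^T *m invmx (B *m B^T) *m (invmx (C^T *m C) *m C^T)) =
    C *m invmx (C^T *m C) *m C^T.
  by rewrite !mulmxA -[C *m B *m B^T]mulmxA -[C *m _ *m invmx _]mulmxA mulmxV //
    mulmx1.
have XC : B^T *m invmx (B *m B^T) *m (invmx (C^T *m C) *m C^T) *m (C *m B) =
    B^T *m invmx (B *m B^T) *m B.
  rewrite !mulmxA -[_ *m C^T *m C]mulmxA -[_ *m invmx _ *m (C^T *m C)]mulmxA.
  by rewrite mulVmx // mulmx1.
split.
- by rewrite CX !mulmxA -[_ *m C^T *m C]mulmxA -[_ *m (C^T *m C)]mulmxA
    mulVmx // mulmx1.
- rewrite XC !mulmxA -[_ *m B *m B^T]mulmxA -[_ *m (B *m B^T) *m _]mulmxA.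
  by rewrite mulmxV // mulmx1.
- by rewrite CX !trmx_mul trmxK trmx_inv trmx_mul trmxK mulmxA.
- by rewrite XC !trmx_mul trmxK trmx_inv trmx_mul trmxK mulmxA.
Qed.

Lemma penrose_uniq (R : realType) (p q : nat) (M : 'M[R]_(p, q)) (X Y : 'M[R]_(q, p)) :
  penrose M X -> penrose M Y -> X = Y.
Proof.
move=> [x1 x2 x3 x4] [y1 y2 y3 y4].
have MXY : M *m X = M *m Y.
  by rewrite -x3 -{1}y1 -[M *m Y *m M *m X]mulmxA trmx_mul x3 y3 mulmxA x1.
have XMY : X *m M = Y *m M.
  by rewrite -x4 -{1}y1 !mulmxA -[X *m M *m Y *m M]mulmxA trmx_mul x4 y4 -mulmxA
    [M *m (X *m M)]mulmxA x1.
by rewrite -x2 -mulmxA MXY mulmxA XMY.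
Qed.

(* The number of columns of S is allowed to be random: a realisation of S is a
   matrix with m rows and any number q of columns. *)
Definition sketch (R : realType) (m : nat) : Type := {q : nat & 'M[R]_(m, q)}.

HB.instance Definition _ (R : realType) (m : nat) := Topological.on (sketch R m).
HB.instance Definition _ (R : realType) (m : nat) :=
  isPointed.Build (sketch R m) (existT (fun q => 'M[R]_(m, q)) 0%N 0).

(* The Borel sigma-algebra of the disjoint union of the spaces 'M_(m, q). *)
HB.instance Definition _ (R : realType) (m : nat) :=
  @isMeasurable.Build (sigma_display (@open (sketch R m))) (sketch R m)
    <<s @open (sketch R m) >>
    (@sigma_algebra0 _ setT _) (@sigma_algebraC _ _)
    (@sigma_algebra_bigcup _ setT _).

Definition sketchH (R : realType) (m n : nat) (A : 'M[R]_(m, n)) (S : sketch R m) :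
    'M[R]_m :=
  let s := projT2 S in s *m pinv (s^T *m A *m A^T *m s) *m s^T.

Definition fS (R : realType) (m n : nat) (A : 'M[R]_(m, n)) (b : 'cV[R]_m)
    (S : sketch R m) (x : 'cV[R]_n) : R :=
  2^-1 * ((A *m x - b)^T *m sketchH A S *m (A *m x - b)) 0 0.

Definition fobj (R : realType) (m n : nat) (A : 'M[R]_(m, n)) (b : 'cV[R]_m)
    (D : probability (sketch R m) R) (x : 'cV[R]_n) : \bar R :=
  ('E_D[fun S => fS A b S x])%E.

Definition minimizers (R : realType) (n : nat) (f : 'cV[R]_n -> \bar R) :
    set 'cV[R]_n :=
  [set x | forall y, (f x <= f y)%E].

Definition solutions (R : realType) (m n : nat) (A : 'M[R]_(m, n)) (b : 'cV[R]_m) :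
    set 'cV[R]_n :=
  [set x | A *m x = b].

Definition is_projection (R : realType) (n : nat) (L : set 'cV[R]_n)
    (x p : 'cV[R]_n) : Prop :=
  L p /\ forall y, L y -> enorm (x - p) <= enorm (x - y).

Definition Wmx (R : realType) (m n : nat) (A : 'M[R]_(m, n))
    (D : probability (sketch R m) R) : 'M[R]_n :=
  \matrix_(i, j) fine ('E_D[fun S => (A^T *m sketchH A S *m A) i j])%E.

(* A matrix has finitely many eigenvalues, so the infimum is a minimum as soon
   as there is a nonzero eigenvalue. *)
Definition lambda_min_pos (R : realType) (n : nat) (M : 'M[R]_n) : R :=
  inf [set l | eigenvalue M l /\ l != 0].

(* The stochastic Polyak step size (g x - inf g) / (c * |grad g x|^2), c = 1/2. *)
Definition sps_half (R : realType) (n : nat) (g : 'cV[R]_n -> R) (x : 'cV[R]_n) : R :=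
  2 * (g x - inf (range g)) / enorm (gradient g x) ^+ 2.

Definition sps_step (R : realType) (n : nat) (g : 'cV[R]_n -> R) (x : 'cV[R]_n) :
    'cV[R]_n :=
  if gradient g x == 0 then x else x - sps_half g x *: gradient g x.

Fixpoint sgd (R : realType) (m n : nat) (A : 'M[R]_(m, n)) (b : 'cV[R]_m)
    (x0 : 'cV[R]_n) (s : nat -> sketch R m) (k : nat) : 'cV[R]_n :=
  if k is j.+1 then sps_step (fS A b (s j)) (sgd A b x0 s j) else x0.

Definition mutually_independent (d d' : measure_display) (R : realType)
    (Omega : measurableType d) (T : measurableType d') (P : probability Omega R)
    (X : nat -> Omega -> T) : Prop :=
  forall (J : {fset nat}) (B : nat -> set T), (forall j, measurable (B j)) ->
    P (\bigcap_(j in [set` J]) (X j @^-1` B j)) =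
    (\prod_(j <- J) P (X j @^-1` B j))%E.

(* Main.v *)
Require Import Defs.
From mathcomp Require Import all_boot all_order all_algebra finmap.
From mathcomp Require Import all_classical all_reals all_analysis.
From mathcomp Require Import measurable_realfun ring lra.

(* For every sketch S the matrix Z_S = A^T H A is the orthogonal projector onto the
   range of A^T S.  With p the projection of x^0 onto the solution set,
   f_S(x) = |Z_S (x - p)|^2 / 2 = |grad f_S(x)|^2 / 2, so the Polyak step size is 1 and
   the error e_k = x^k - p obeys e_{k+1} = e_k - Z_{S_k} e_k.  Hence
   |e_{k+1}|^2 = |e_k|^2 - <e_k, Z_{S_k} e_k>, and by independence of S_k from e_k the
   mean of the last term is that of <e_k, W e_k>.  Exactness means that ker W = ker A;
   since e_k stays orthogonal to ker A, the Rayleigh bound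
   <e_k, W e_k> >= lambda_min^+(W) |e_k|^2 applies and the error contracts. *)

Set Implicit Arguments.
Unset Strict Implicit.
Unset Printing Implicit Defensive.

Import Order.TTheory GRing.Theory Num.Theory.
Import numFieldNormedType.Exports.

Local Open Scope classical_set_scope.
Local Open Scope ring_scope.

(** * Orthogonal projectors and the sketched projection *)

Section dot.
Context {R : realType} {n : nat}.
Implicit Types (u v w : 'cV[R]_n) (M : 'M[R]_n).

Definition dot u v : R := \sum_i u i 0 * v i 0.

Lemma dotE u v : dot u v = (u^T *m v) 0 0.
Proof. by rewrite mxE; apply: eq_bigr => i _; rewrite mxE. Qed.

Lemma enorm_sqr u : enorm u ^+ 2 = dot u u.
Proof.
by rewrite sqr_sqrtr; [apply: eq_bigr => i _|apply: sumr_ge0 => i _; rewrite sqr_ge0].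
Qed.

Lemma dotC u v : dot u v = dot v u.
Proof. by apply: eq_bigr => i _; rewrite mulrC. Qed.

Lemma dotDl u v w : dot (u + v) w = dot u w + dot v w.
Proof. by rewrite -big_split; apply: eq_bigr => i _; rewrite mxE mulrDl. Qed.

Lemma dotZl a u v : dot (a *: u) v = a * dot u v.
Proof. by rewrite mulr_sumr; apply: eq_bigr => i _; rewrite mxE mulrA. Qed.

Lemma dotNl u v : dot (- u) v = - dot u v.
Proof. by rewrite -scaleN1r dotZl mulN1r. Qed.

Lemma dotDr u v w : dot u (v + w) = dot u v + dot u w.
Proof. by rewrite dotC dotDl !(dotC u). Qed.

Lemma dotZr a u v : dot u (a *: v) = a * dot u v.
Proof. by rewrite dotC dotZl dotC. Qed.

Lemma dotNr u v : dot u (- v) = - dot u v.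
Proof. by rewrite dotC dotNl dotC. Qed.

Lemma dot0l u : dot 0 u = 0.
Proof. by rewrite -(scale0r 0) dotZl mul0r. Qed.

Lemma dot0r u : dot u 0 = 0.
Proof. by rewrite dotC dot0l. Qed.

Definition dotl := (dotDl, dotDr, dotNl, dotNr, dotZl, dotZr).

Lemma dot_ge0 u : 0 <= dot u u.
Proof. by apply: sumr_ge0 => i _; rewrite -expr2 sqr_ge0. Qed.

Lemma dot_eq0 u : (dot u u == 0) = (u == 0).
Proof.
apply/idP/eqP => [|->]; last by rewrite dot0l.
rewrite psumr_eq0 => [/allP h|i _]; last by rewrite -expr2 sqr_ge0.
apply/colP => i; have := h i (mem_index_enum i).
by rewrite /= -expr2 sqrf_eq0 mxE => /eqP.
Qed.

Lemma dot_gt0 u : u != 0 -> 0 < dot u u.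
Proof. by rewrite lt_def dot_ge0 dot_eq0 andbT. Qed.

Lemma dot_sum2 M u : dot u (M *m u) = \sum_i \sum_j u i 0 * u j 0 * M i j.
Proof.
apply: eq_bigr => i _; rewrite mxE mulr_sumr; apply: eq_bigr => j _; ring.
Qed.

Lemma coord_sqr_le u i : u i 0 ^+ 2 <= dot u u.
Proof.
rewrite /dot (bigD1 i) //= -expr2 lerDl.
by apply: sumr_ge0 => j _; rewrite -expr2 sqr_ge0.
Qed.

End dot.

Lemma dot_mulmx (R : realType) (p q : nat) (M : 'M[R]_(p, q)) (u : 'cV[R]_p)
    (v : 'cV[R]_q) :
  dot u (M *m v) = dot (M^T *m u) v.
Proof. by rewrite !dotE trmx_mul trmxK mulmxA. Qed.

(** The diagonal entries of [N^T *m N] are the squared norms of the columns of [N]. *)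
Lemma gram_eq0 (R : realType) (p q : nat) (N : 'M[R]_(p, q)) :
  N^T *m N = 0 -> N = 0.
Proof.
move=> NN; apply/matrixP => i j; rewrite mxE.
have /eqP : dot (col j N) (col j N) = 0.
  have : (N^T *m N) j j = 0 by rewrite NN mxE.
  by rewrite mxE => <-; apply: eq_bigr => k _; rewrite !mxE.
by rewrite dot_eq0 => /eqP/colP/(_ i); rewrite !mxE.
Qed.

Definition orthoproj (R : realType) (n : nat) (Z : 'M[R]_n) : Prop :=
  Z^T = Z /\ Z *m Z = Z.

Section orthoproj.
Context {R : realType} {n : nat} (Z : 'M[R]_n) (Zp : orthoproj Z).
Implicit Types u v : 'cV[R]_n.

Lemma dot_proj u : dot u (Z *m u) = dot (Z *m u) (Z *m u).
Proof. by have [ZT ZZ] := Zp; rewrite [RHS]dot_mulmx ZT mulmxA ZZ dotC. Qed.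

Lemma dot_proj_ge0 u : 0 <= dot u (Z *m u).
Proof. by rewrite dot_proj dot_ge0. Qed.

Lemma dot_projB u : dot (u - Z *m u) (u - Z *m u) = dot u u - dot u (Z *m u).
Proof. by have := dot_proj u; rewrite !dotl (dotC (Z *m u) u); lra. Qed.

Lemma dot_proj_le u : dot u (Z *m u) <= dot u u.
Proof. by rewrite -subr_ge0 -dot_projB dot_ge0. Qed.

(** Since Z = Z Z^T, the diagonal entry Z_kk is the squared norm of row k. Hence Z_ii^2 <= Z_ii, so
    Z_ii <= 1, and Z_ij^2 <= Z_ii. This uniform bound makes every moment of the random projector
    finite. *)
Lemma proj_coord_le1 i j : `|Z i j| <= 1.
Proof.
have [ZT ZZ] := Zp.
have Zdiag k : Z k k = \sum_l Z k l ^+ 2.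
  by rewrite -{1}ZZ mxE; apply: eq_bigr => l _; rewrite expr2 -{2}ZT mxE.
have le1 k l : Z k l ^+ 2 <= Z k k.
  by rewrite Zdiag (bigD1 l) //= lerDl sumr_ge0 // => ? _; rewrite sqr_ge0.
have Zii : Z i i <= 1 by have := le1 i i; nra.
rewrite -(@expr_le1 _ 2) // real_normK ?num_real //.
exact: le_trans (le1 i j) Zii.
Qed.

End orthoproj.

(** * The projector onto the range of A^T S *)

Section sketch_projection.
Context {R : realType} {m n : nat} (A : 'M[R]_(m, n)).
Implicit Types (S : sketch R m) (u v : 'cV[R]_n).

Definition sketchZ S : 'M[R]_n := A^T *m sketchH A S *m A.

Let gram S := let B := A^T *m projT2 S in B^T *m B.

(** Transposing the Penrose equations of a symmetric [M] exchanges the last two and shows that the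
    transpose of the pseudoinverse solves them too; uniqueness concludes. *)
Lemma pinv_sym (q : nat) (M : 'M[R]_q) : M^T = M -> (Defs.pinv M)^T = Defs.pinv M.
Proof.
move=> MT; have [h1 h2 h3 h4] := pinvP M.
apply: (penrose_uniq (M := M)); last exact: pinvP.
split.
- by rewrite -{1 3}MT -!trmx_mul mulmxA h1.
- by rewrite -{2}MT -!trmx_mul mulmxA h2.
- by rewrite trmx_mul trmxK MT -h4 trmx_mul MT.
- by rewrite trmx_mul trmxK MT -h3 trmx_mul MT.
Qed.

Lemma sketchZE S : sketchZ S =
  (A^T *m projT2 S) *m Defs.pinv (gram S) *m (A^T *m projT2 S)^T.
Proof.
rewrite /sketchZ /sketchH /gram trmx_mul trmxK.
by rewrite !mulmxA.
Qed.

Lemma gram_sym S : (gram S)^T = gram S.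
Proof. by rewrite trmx_mul trmxK. Qed.

Lemma sketchZ_proj S : orthoproj (sketchZ S).
Proof.
rewrite sketchZE; have [h1 h2 h3 h4] := pinvP (gram S).
have GT := pinv_sym (gram_sym S).
rewrite /gram in h2 GT *; move: (A^T *m _) h2 GT => B h2 GT; split.
  by rewrite [LHS]trmx_mul trmxK trmx_mul GT mulmxA.
by rewrite -[in RHS]h2 !mulmxA.
Qed.

(** Put B = A^T S and let G be the pseudoinverse of [gram S] = B^T B. By symmetry G commutes with
    B^T B, so G = G^2 B^T B and Z = B G B^T = (B G^2 B^T)(B B^T). The factor B B^T has size n
    whatever the number of columns of S, which serves the measurability proof. *)
Lemma sketchZ_factor S : exists Q : 'M[R]_n,
  sketchZ S = Q *m (A^T *m (projT2 S *m (projT2 S)^T) *m A).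
Proof.
have [h1 h2 h3 h4] := pinvP (gram S).
have GT := pinv_sym (gram_sym S).
have GM : Defs.pinv (gram S) *m gram S = gram S *m Defs.pinv (gram S).
  by rewrite -h3 trmx_mul GT gram_sym.
rewrite sketchZE; set G := Defs.pinv _ in h2 GM *; set B := A^T *m projT2 S.
exists (B *m G *m G *m B^T).
have -> : A^T *m (projT2 S *m (projT2 S)^T) *m A = B *m B^T.
  by rewrite /B trmx_mul trmxK !mulmxA.
have : G *m G *m gram S = G by rewrite -mulmxA GM mulmxA h2.
rewrite /gram -/B => GGM.
by rewrite -{1}GGM !mulmxA.
Qed.

Lemma sketchZ_ker S v : A *m v = 0 -> sketchZ S *m v = 0.
Proof. by move=> Av; rewrite /sketchZ -mulmxA Av mulmx0. Qed.

(** It suffices that Z fixes B = A^T S. The defect N = Z B - B is B times a matrix and satisfies B^T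
    N = 0 by the first Penrose equation, so N^T N = 0. *)
Lemma sketchZK S :
  sketchZ S *m (A^T *m (projT2 S *m (projT2 S)^T) *m A) =
  A^T *m (projT2 S *m (projT2 S)^T) *m A.
Proof.
have [h1 h2 h3 h4] := pinvP (gram S).
rewrite sketchZE; set G := Defs.pinv _ in h1 *; set B := A^T *m projT2 S.
have -> : A^T *m (projT2 S *m (projT2 S)^T) *m A = B *m B^T.
  by rewrite /B trmx_mul trmxK !mulmxA.
have {}h1 : B^T *m B *m G *m (B^T *m B) = B^T *m B := h1.
clearbody G B; rewrite !mulmxA in h1.
suff : B *m G *m B^T *m B = B by move=> e; rewrite mulmxA e.
apply/eqP; rewrite -subr_eq0; apply/eqP; set N := _ - B.
have N0 : B^T *m N = 0 by rewrite /N mulmxBr !mulmxA h1 subrr.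
apply: gram_eq0; rewrite {1}/N [(_ - _)^T]linearB /= mulmxBl N0 subr0 !trmx_mul !trmxK.
by rewrite -!mulmxA N0 !mulmx0.
Qed.

End sketch_projection.

(** * The Polyak step *)

Section quadratic.
Context {R : realType} {n : nat} (Z : 'M[R]_n) (Zp : orthoproj Z) (c : 'cV[R]_n).
Implicit Types (x v : 'cV[R]_n).

Let q x := 2^-1 * dot (x - c) (Z *m (x - c)).

Lemma derive_quadratic x v : 'D_v q x = dot v (Z *m (x - c)).
Proof.
have [ZT ZZ] := Zp; apply: cvg_lim => //.
(* For h != 0 the difference quotient of [q] is exactly this affine function of h. *)
have lin : (fun h : R => dot v (Z *m (x - c)) + h * (2^-1 * dot v (Z *m v))) @ 0^'
    --> dot v (Z *m (x - c)) + 0 * (2^-1 * dot v (Z *m v)).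
  apply: cvgD; first exact: cvg_cst.
  by apply: cvgM; [exact: nbhs_dnbhs|exact: cvg_cst].
rewrite mul0r addr0 in lin; apply: cvg_trans lin.
apply: near_eq_cvg; near=> h => /=.
have h0 : h != 0 by near: h; exact: nbhs_dnbhs_neq.
rewrite /q -[_ + x - c]addrA; move: (x - c) => e.
rewrite mulmxDr -scalemxAr !dotl.
have -> : dot e (Z *m v) = dot v (Z *m e) by rewrite dot_mulmx ZT dotC.
by rewrite /GRing.scale /=; field.
Unshelve. all: by end_near.
Qed.

Lemma gradient_quadratic x : gradient q x = Z *m (x - c).
Proof.
apply/colP => i; rewrite mxE derive_quadratic /dot (bigD1 i) //= big1 ?addr0.
  by rewrite !mxE !eqxx mul1r.
by move=> j /negbTE ji; rewrite mxE ji mul0r.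
Qed.

Lemma inf_quadratic : inf (range q) = 0.
Proof.
have q0 : lbound (range q) 0.
  by move=> _ [x _ <-]; rewrite mulr_ge0 // dot_proj_ge0.
have qc : range q 0 by exists c => //; rewrite /q subrr dot0l mulr0.
apply/eqP; rewrite eq_le; apply/andP; split.
  by apply: ge_inf => //; exists 0.
by apply: lb_le_inf => //; exists 0.
Qed.

(* The Polyak step size equals 1 because q x - inf q is half the squared gradient norm. *)
Lemma sps_step_quadratic x : sps_step q x - c = (x - c) - Z *m (x - c).
Proof.
rewrite /sps_step gradient_quadratic; case: eqP => [->|/eqP g0].
  by rewrite subr0.
rewrite /sps_half gradient_quadratic enorm_sqr inf_quadratic /q subr0.
rewrite dot_proj // mulrA divff // mul1r divff ?dot_eq0 // scale1r.
by rewrite addrAC.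
Qed.

End quadratic.

(** Any solution [c] of the system can serve as the centre, because A x - b = A (x - c). *)
Lemma fS_quadratic (R : realType) (m n : nat) (A : 'M[R]_(m, n)) (b : 'cV[R]_m)
    (S : sketch R m) (c : 'cV[R]_n) : A *m c = b ->
  fS A b S = fun x => 2^-1 * dot (x - c) (sketchZ A S *m (x - c)).
Proof.
move=> <-; apply/funext => x; rewrite /fS -mulmxBr dotE /sketchZ.
by rewrite trmx_mul !mulmxA.
Qed.

Lemma sgd_error (R : realType) (m n : nat) (A : 'M[R]_(m, n)) (b : 'cV[R]_m)
    (x0 c : 'cV[R]_n) (s : nat -> sketch R m) (k : nat) : A *m c = b ->
  sgd A b x0 s k.+1 - c =
  (sgd A b x0 s k - c) - sketchZ A (s k) *m (sgd A b x0 s k - c).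
Proof.
by move=> Ac; rewrite /= (fS_quadratic _ Ac) sps_step_quadratic //;
  exact: sketchZ_proj.
Qed.

(** * Orthogonality of the initial error to the kernel of A *)

Section projection.
Context {R : realType} {m n : nat} (A : 'M[R]_(m, n)) (b : 'cV[R]_m).

Lemma projection_orthogonal (x p v : 'cV[R]_n) :
  is_projection (solutions A b) x p -> A *m v = 0 -> dot (x - p) v = 0.
Proof.
move=> [Ap pmin] Av; have [->|v0] := eqVneq v 0; first by rewrite dot0r.
have vv := dot_gt0 v0.
(* This t minimises |x - p - t v|^2, lowering it by t^2 |v|^2. The point p + t v is still a
   solution, so minimality of p forces t = 0. *)
pose t := dot (x - p) v / dot v v.
have Apt : solutions A b (p + t *: v).
  by rewrite /solutions /= mulmxDr -scalemxAr Av scaler0 addr0.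
have := pmin _ Apt; rewrite -ler_sqr ?nnegrE ?sqrtr_ge0 // !enorm_sqr.
rewrite opprD addrA.
have tv : dot (x - p) v = t * dot v v by rewrite divfK ?gt_eqF.
move: tv; move: t (x - p) {Apt} => t e tv.
rewrite !dotl (dotC v e) tv; move: (dot e e) (dot v v) vv => a w w0; nra.
Qed.

End projection.

(** * The Rayleigh bound on the complement of the kernel *)

Lemma continuous_dot (R : realType) (n : nat) (T : topologicalType)
    (F G : T -> 'cV[R]_n) :
  (forall i, continuous (fun t => F t i 0)) ->
  (forall i, continuous (fun t => G t i 0)) ->
  continuous (fun t => dot (F t) (G t)).
Proof.
move=> cF cG; rewrite /dot; apply: continuous_big => [|i _ t].
  by apply: add_continuous.
by apply: cvgM; [exact: cF|exact: cG].
Qed.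

Lemma linear_coef_eq0 (R : realType) (a c : R) :
  (forall s, 0 <= s * a + s ^+ 2 * c) -> a = 0.
Proof.
move=> h; pose C := `|c| + 1.
have C0 : 0 < C by rewrite /C ltr_wpDl.
have cC : c <= C by rewrite (le_trans (ler_norm c)) // lerDl.
(* At this s one has s a = - 2 C s^2, so the hypothesis reads 0 <= s^2 (c - 2 C) with a negative
   second factor; hence s = 0. *)
have := h (- a / (2 * C)).
have -> : - a / (2 * C) * a + (- a / (2 * C)) ^+ 2 * c =
    (a / (2 * C)) ^+ 2 * (c - 2 * C) by field; rewrite gt_eqF.
have cC0 : c - 2 * C < 0 by lra.
rewrite nmulr_lge0 // => h1.
have : (a / (2 * C)) ^+ 2 == 0 by rewrite eq_le h1 sqr_ge0.
by rewrite sqrf_eq0 mulf_eq0 invr_eq0 mulf_eq0 !(gt_eqF C0) pnatr_eq0 !orbF => /eqP.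
Qed.

Section rayleigh.
Context {R : realType} {n : nat} (W : 'M[R]_n).
Hypotheses (Wsym : W^T = W) (Wpsd : forall u, 0 <= dot u (W *m u)).
Implicit Types u v : 'cV[R]_n.

(** For symmetric [W] the orthogonal complement of the kernel is the range of [W]; restricting to it
    removes the eigenvalue 0. *)
Let perp u := forall v, W *m v = 0 -> dot u v = 0.

Lemma dot_symmx u v : dot u (W *m v) = dot v (W *m u).
Proof. by rewrite dot_mulmx Wsym dotC. Qed.

(** The quadratic form of [W] attains its minimum on the unit sphere of the complement of the
    kernel, which is compact and contains the normalised [u]. Scaling extends the bound to all
    vectors of the complement. *)
Lemma min_on_perp_sphere u : perp u -> u != 0 ->
  exists v, [/\ perp v, dot v v = 1 &
    forall w, perp w -> dot v (W *m v) * dot w w <= dot w (W *m w)].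
Proof.
move=> pu u0.
pose K := [set t : 'rV[R]_n | perp t^T /\ dot t^T t^T = 1].
have nrm w : perp w -> w != 0 -> K ((Num.sqrt (dot w w))^-1 *: w)^T.
  move=> pw w0; have ww := dot_gt0 w0; rewrite /K /= trmxK; split.
    by move=> v Wv; rewrite dotZl (pw _ Wv) mulr0.
  rewrite dotZl dotZr mulrA -expr2 exprVn sqr_sqrtr ?dot_ge0 //.
  by rewrite mulVf ?gt_eqF.
have ctr i : continuous (fun t : 'rV[R]_n => t^T i 0 : R).
  under eq_fun do rewrite mxE; exact: coord_continuous.
have ccst v i : continuous (fun _ : 'rV[R]_n => v i 0 : R).
  exact: cst_continuous.
have cW i : continuous (fun t : 'rV[R]_n => (W *m t^T) i 0 : R).
  rewrite (_ : (fun t => _) = fun t => \sum_j W i j * t^T j 0); last first.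
    by apply/funext => t; rewrite mxE.
  apply: continuous_big => [|j _ t].
    by apply: add_continuous.
  by apply: continuousM; [exact: cst_continuous|exact: ctr].
(* [K] is a closed subset of the cube [-1, 1]^n: it is cut out by the equations of orthogonality and
   of unit norm. *)
have cK : compact K.
  apply: (@subclosed_compact _ _
    [set t : 'rV[R]_n | forall i, `[(-1 : R), 1]%classic (t ord0 i)]).
  - have -> : K = \bigcap_(v in [set v | W *m v = 0])
          ((fun t : 'rV[R]_n => dot t^T v) @^-1` [set 0]) `&`
        ((fun t : 'rV[R]_n => dot t^T t^T) @^-1` [set 1]).
      by apply/seteqP; split => t.
    apply: closedI; first apply: closed_bigI => v _.
      apply: preimage_closed; last exact: closed_eq.
      by move=> t _; apply: continuous_dot.
    apply: preimage_closed; last exact: closed_eq.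
    by move=> t _; apply: continuous_dot.
  - by apply: (@rV_compact _ _ (fun=> `[(-1 : R), 1]%classic)) => _;
      exact: segment_compact.
  - move=> t [_ t1] i; have := coord_sqr_le t^T i.
    rewrite t1 mxE /= in_itv /= -ler_norml => h.
    by rewrite -(@expr_le1 _ 2) // real_normK ?num_real.
have [] := @compact_EVT_min _ R (fun t : 'rV[R]_n => dot t^T (W *m t^T)) K _ cK _.
- by exists ((Num.sqrt (dot u u))^-1 *: u)^T; exact: nrm.
- by apply: continuous_subspaceT; apply: continuous_dot.
move=> c; rewrite inE => -[pc c1] cmin; exists c^T; split => // w pw.
have [->|w0] := eqVneq w 0; first by rewrite mulmx0 !dot0r mulr0.
have := cmin _ (mem_set (nrm w pw w0)); rewrite trmxK -scalemxAr dotZl dotZr.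
rewrite mulrA -expr2 exprVn sqr_sqrtr ?dot_ge0 // mulrC.
by rewrite ler_pdivlMr ?dot_gt0.
Qed.

(** A minimiser v of the Rayleigh quotient on the complement of the kernel is an eigenvector: the
    residual w = W v - mu v stays in the complement, and the first-order condition along w gives
    |w|^2 = 0. *)
Lemma perp_eigenvector u : perp u -> u != 0 ->
  exists2 mu, eigenvalue W mu /\ mu != 0 &
    mu * dot u u <= dot u (W *m u).
Proof.
move=> pu u0; have [v [pv v1 vmin]] := min_on_perp_sphere pu u0.
set mu := dot v (W *m v) in vmin; exists mu; last exact: vmin.
have v0 : v != 0 by rewrite -dot_eq0 v1 oner_neq0.
have Wv : W *m v = mu *: v.
  have [w wE] : exists w, w = W *m v - mu *: v by exists (W *m v - mu *: v).
  have pw : perp w.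
    move=> x Wx; rewrite wE !dotl (pv _ Wx) mulr0 oppr0 addr0.
    by rewrite dotC dot_symmx Wx dot0r.
  have ww : dot w w = dot w (W *m v) - mu * dot w v by rewrite {2}wE !dotl.
  have : 2 * (dot w (W *m v) - mu * dot w v) = 0.
    (* Minimality at v + s w gives a quadratic in s without constant term; its linear coefficient is
       twice <w, W v - mu v>. *)
    apply: (@linear_coef_eq0 _ _ (dot w (W *m w) - mu * dot w w)) => s.
    suff : perp (v + s *: w).
      move/(vmin (v + s *: w)); rewrite mulmxDr -scalemxAr !dotl.
      rewrite v1 (dot_symmx v w) (dotC v w) -/mu.
      move: (dot w (W *m v)) (dot w v) (dot w (W *m w)) (dot w w) => a1 a2 a3 a4.
      by nra.
    by move=> x Wx; rewrite !dotl (pv _ Wx) (pw _ Wx) mulr0 addr0.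
  rewrite -ww => /eqP; rewrite mulf_eq0 pnatr_eq0 /= dot_eq0 wE subr_eq0 => /eqP //.
split.
  apply/eigenvalueP; exists v^T; last by rewrite trmx_eq0.
  by rewrite -{1}Wsym -trmx_mul Wv linearZ.
(* If mu were 0, v would lie in the kernel and be orthogonal to it, against |v| = 1. *)
apply/negP => /eqP mu0; move: Wv; rewrite mu0 scale0r => /pv.
by rewrite v1 => /eqP; rewrite oner_eq0.
Qed.

Lemma eigenvalue_psd_ge0 mu : eigenvalue W mu -> 0 <= mu.
Proof.
move=> /eigenvalueP[v vW v0]; have := Wpsd v^T.
have -> : W *m v^T = mu *: v^T by rewrite -{1}Wsym -trmx_mul vW linearZ.
by rewrite dotZr pmulr_lge0 // dot_gt0 // trmx_eq0.
Qed.

(** The value from [perp_eigenvector] belongs to the set whose infimum is taken. Positive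
    semidefiniteness bounds that set below by 0, so the infimum is a true lower bound. *)
Lemma lambda_min_pos_rayleigh u : perp u ->
  lambda_min_pos W * dot u u <= dot u (W *m u).
Proof.
move=> pu; have [->|u0] := eqVneq u 0; first by rewrite mulmx0 !dot0r mulr0.
have [mu emu muu] := perp_eigenvector pu u0; apply: le_trans muu.
rewrite ler_wpM2r ?dot_ge0 //; apply: ge_inf => //.
by exists 0 => l [/eigenvalue_psd_ge0].
Qed.

(** Makes the contraction factor 1 - lambda nonnegative, so that the one-step bound can be
    iterated. *)
Lemma lambda_min_pos_le1 : (forall u, dot u (W *m u) <= dot u u) ->
  lambda_min_pos W <= 1.
Proof.
move=> Wle; rewrite /lambda_min_pos; set E := [set _ | _].
(* Without nonzero eigenvalues the infimum is that of the empty set, which is 0 by convention. *)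
have [->|/set0P[mu Emu]] := eqVneq E set0; first by rewrite inf0.
apply: (@le_trans _ _ mu).
  by apply: ge_inf => //; exists 0 => l [/eigenvalue_psd_ge0].
have [/eigenvalueP[v vW v0] _] := Emu; have := Wle v^T.
have -> : W *m v^T = mu *: v^T by rewrite -{1}Wsym -trmx_mul vW linearZ.
by rewrite dotZr ger_pMl // dot_gt0 // trmx_eq0.
Qed.


End rayleigh.

(** * Measurability of the sketched projection *)

(** A subset of the disjoint union is open as soon as its trace on each component is open, so
    continuity for every fixed number of columns gives Borel measurability. *)
Lemma measurable_sketch (R : realType) (m : nat) (f : sketch R m -> R) :
  (forall q, continuous (fun M : 'M[R]_(m, q) => f (existT _ q M))) ->
  measurable_fun setT f.
Proof.
move=> cf; apply: (measurability _ (RGenOpens.measurableE R)).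
move=> _ [_ [a [b ->] <-]]; rewrite setTI; apply: sub_sigma_algebra.
apply/sigT_openP => q.
by have /continuousP := cf q; apply; exact: interval_open.
Qed.

Lemma measurable_funV (R : realType) (d : measure_display) (T : measurableType d)
    (f : T -> R) :
  measurable_fun setT f -> measurable_fun setT (fun x => (f x)^-1).
Proof.
move=> mf.
(* [powR] is measurable, but agrees with the inverse only on nonnegative arguments *)
rewrite (_ : (fun x => _) = fun x => f x * (f x ^+ 2) `^ (-1)); last first.
  apply/funext => x; rewrite powR_inv1 ?sqr_ge0 //.
  have [->|fx0] := eqVneq (f x) 0; first by rewrite invr0 mul0r.
  by field.
apply: measurable_funM => //; apply: (measurableT_comp (measurable_powR (-1))).
exact: measurable_funX.
Qed.

Section measurable_matrix.
Context {R : realType} {d : measure_display} {T : measurableType d}.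

Definition measurable_mx (p q : nat) (F : T -> 'M[R]_(p, q)) :=
  forall i j, measurable_fun setT (fun t => F t i j).

Lemma measurable_det (p : nat) (F : T -> 'M[R]_p) :
  measurable_mx F -> measurable_fun setT (fun t => \det (F t)).
Proof.
move=> mF; apply: measurable_sum => s; apply: measurable_funM => //.
by apply: measurable_prod => i _; exact: mF.
Qed.

Lemma measurable_mulmx (p q r : nat) (F : T -> 'M[R]_(p, q)) (G : T -> 'M[R]_(q, r)) :
  measurable_mx F -> measurable_mx G -> measurable_mx (fun t => F t *m G t).
Proof.
move=> mF mG i j; under eq_fun do rewrite mxE.
by apply: measurable_sum => k; apply: measurable_funM; [exact: mF|exact: mG].
Qed.

Lemma measurable_cstmx (p q : nat) (M : 'M[R]_(p, q)) :
  measurable_mx (fun _ : T => M).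
Proof. by move=> i j; exact: measurable_cst. Qed.

(** By the cofactor formula each entry of the inverse is a quotient of determinants. *)
Lemma measurable_invmx (p : nat) (F : T -> 'M[R]_p) :
  (forall t, F t \in unitmx) -> measurable_mx F ->
  measurable_mx (fun t => invmx (F t)).
Proof.
move=> uF mF i j.
rewrite (_ : (fun t => _) = fun t => (\det (F t))^-1 * cofactor (F t) j i); last first.
  by apply/funext => t; rewrite /invmx uF !mxE.
apply: measurable_funM; first exact/measurable_funV/measurable_det.
apply: measurable_funM => //; apply: measurable_det => k l.
by under eq_fun do rewrite !mxE; exact: mF.
Qed.

End measurable_matrix.

(** * Shifted positive semidefinite matrices *)

Section regularised_inverse.
Context {R : realType} {n : nat} (K : 'M[R]_n).
Hypothesis Kpsd : forall u, 0 <= dot u (K *m u).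

Lemma dot_shift_ge (e : R) (u : 'cV[R]_n) :
  e * dot u u <= dot u ((K + e%:M) *m u).
Proof. by rewrite mulmxDl mul_scalar_mx dotDr dotZr lerDr. Qed.

Lemma unitmx_shift (e : R) : 0 < e -> K + e%:M \in unitmx.
Proof.
move=> e0; rewrite -unitmx_tr -row_free_unit -kermx_eq0.
apply/eqP/row_matrixP => i; rewrite row0; set v := row i _.
have vK : v *m (K + e%:M)^T = 0 by rewrite /v -row_mul mulmx_ker row0.
have {}vK : (K + e%:M) *m v^T = 0 by rewrite -[LHS]trmxK trmx_mul trmxK vK trmx0.
have := dot_shift_ge e v^T; rewrite vK dot0r pmulr_rle0 // => v0.
by apply: trmx_inj; apply/eqP; rewrite trmx0 -dot_eq0 eq_le v0 dot_ge0.
Qed.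

Lemma shift_inv_le (e : R) (u : 'cV[R]_n) : 0 < e ->
  dot (e *: (invmx (K + e%:M) *m u)) (e *: (invmx (K + e%:M) *m u)) <= dot u u.
Proof.
move=> e0; set w := e *: _.
have Kw : (K + e%:M) *m w = e *: u.
  by rewrite /w -scalemxAr mulKVmx // unitmx_shift.
have := dot_shift_ge e w; rewrite Kw dotZr ler_pM2l // => wu.
clearbody w.
(* From |w|^2 <= <w, u> and 2 <w, u> <= |w|^2 + |u|^2 follows |w|^2 <= |u|^2. *)
have := dot_ge0 (w - u); rewrite !dotl (dotC u w); lra.
Qed.

End regularised_inverse.

Section sketchZ_measurable.
Context {R : realType} {m n : nat} (A : 'M[R]_(m, n)).

Let K (S : sketch R m) := A^T *m (projT2 S *m (projT2 S)^T) *m A.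

Let Kpsd S u : 0 <= dot u (K S *m u).
Proof.
have -> : K S = (A^T *m projT2 S) *m (A^T *m projT2 S)^T.
  by rewrite /K trmx_mul trmxK !mulmxA.
by rewrite -mulmxA dot_mulmx dot_ge0.
Qed.

Let measurable_K : measurable_mx K.
Proof.
apply: measurable_mulmx; last exact: measurable_cstmx.
apply: measurable_mulmx; first exact: measurable_cstmx.
move=> i j; apply: measurable_sketch => q /=.
rewrite (_ : (fun M : 'M[R]_(m, q) => _) = fun M => \sum_k M i k * M j k); last first.
  by apply/funext => M; rewrite mxE; apply: eq_bigr => k _; rewrite mxE.
apply: continuous_big => [|k _ M]; first exact: add_continuous.
by apply: continuousM; exact: coord_continuous.
Qed.

(** Tikhonov regularisation of the projector: unlike the pseudoinverse, the shifted inverse is a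
    true inverse and so visibly measurable. *)
Let Zreg (k : nat) S := K S *m invmx (K S + (k.+1%:R^-1)%:M).

(* Since Z = Q K = Z K, the error Z - K (K + e)^-1 equals e Q (1 - e (K + e)^-1), and
   e (K + e)^-1 is a contraction. *)
Let Zreg_bound k S Q i j : sketchZ A S = Q *m K S ->
  `|sketchZ A S i j - Zreg k S i j| <= k.+1%:R^-1 * (\sum_l `|Q i l| * 2).
Proof.
set e := k.+1%:R^-1 => ZQ; have e0 : 0 < e by rewrite invr_gt0.
have uK := unitmx_shift (@Kpsd S) e0.
set N := e *: (invmx (K S + e%:M)).
have NE : K S *m invmx (K S + e%:M) = 1%:M - N.
  by rewrite -{1}[K S](addrK e%:M) mulmxBl mulmxV // mul_scalar_mx.
have Nle a b : `|N a b| <= 1.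
  have := shift_inv_le (@Kpsd S) (delta_mx b 0) e0.
  rewrite -colE -/e.
  have := coord_sqr_le (e *: col b (invmx (K S + e%:M))) a.
  have -> : dot (delta_mx b 0 : 'cV[R]_n) (delta_mx b 0) = 1.
    rewrite /dot (bigD1 b) //= big1 ?addr0 => [|l /negbTE lb].
      by rewrite !mxE !eqxx mulr1.
    by rewrite mxE lb mul0r.
  move=> h1 h2; rewrite -(@expr_le1 _ 2) // real_normK ?num_real //.
  by move: (le_trans h1 h2); rewrite !mxE.
clearbody N.
have -> : sketchZ A S i j - Zreg k S i j = e * \sum_l Q i l * (1%:M - N) l j.
  transitivity ((sketchZ A S - Zreg k S) i j); first by rewrite !mxE.
  have -> : sketchZ A S - Zreg k S = e *: (Q *m (1%:M - N)).
    rewrite -NE mulmxA -ZQ -{1}(mulmxK uK (sketchZ A S)) /Zreg -/e -mulmxBl.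
    by rewrite mulmxDr sketchZK addrC addKr mul_mx_scalar -scalemxAl.
  by rewrite !mxE.
rewrite normrM gtr0_norm // ler_pM2l //.
apply: le_trans (ler_norm_sum _ _ _) _; apply: ler_sum => l _.
rewrite normrM ler_wpM2l // !mxE (le_trans (ler_normB _ _)) //.
have -> : 2 = 1 + 1 :> R by [].
by apply: lerD => //; case: (l == j); rewrite ?normr1 ?normr0.
Qed.

(** The projector is the pointwise limit of the measurable [Zreg k]. The bound may depend on S
    through Q, as only pointwise convergence is required. *)
Lemma measurable_sketchZ : measurable_mx (sketchZ A).
Proof.
move=> i j; apply: (@measurable_fun_cvg _ _ _ _ (fun k S => Zreg k S i j)).
  move=> k; apply: measurable_mulmx i j => //.
  apply: measurable_invmx => [S|i j]; first by rewrite unitmx_shift.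
  rewrite (_ : (fun S => _) = fun S => K S i j + (k.+1%:R^-1)%:M i j); last first.
    by apply/funext => S; rewrite mxE.
  by apply: measurable_funD; [exact: measurable_K|exact: measurable_cst].
move=> S _; have [Q ZQ] := sketchZ_factor A S.
apply/cvgrPdist_le => e e0; near=> k.
apply: le_trans (Zreg_bound k i j ZQ) _.
near: k.
have : (fun k => k.+1%:R^-1 * (\sum_l `|Q i l| * 2)) @ \oo --> 0 * (\sum_l `|Q i l| * 2).
  by apply: cvgM; [exact: cvg_harmonic|exact: cvg_cst].
rewrite mul0r => /cvgrPdist_le /(_ _ e0); apply: filterS => k.
by rewrite sub0r normrN; apply: le_trans; exact: ler_norm.
Unshelve. all: by end_near.
Qed.

End sketchZ_measurable.

(** * Product rule for independent variables *)

Section bounded_measurable.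
Context {R : realType} {d : measure_display} {T : measurableType d}.
Implicit Types f g : T -> R.

(** A class closed under sums and products whose members are integrable for every probability
    measure, so that no integrability has to be tracked separately. *)
Definition bounded_measurable f :=
  measurable_fun setT f /\ exists M, forall t, `|f t| <= M.

Lemma bounded_measurable_cst c : bounded_measurable (fun=> c).
Proof. by split; [exact: measurable_cst|exists `|c|]. Qed.

Lemma bounded_measurableD f g : bounded_measurable f -> bounded_measurable g ->
  bounded_measurable (fun t => f t + g t).
Proof.
move=> [mf [M fM]] [mg [N gN]]; split; first exact: measurable_funD.
by exists (M + N) => t; rewrite (le_trans (ler_normD _ _)) // lerD.
Qed.

Lemma bounded_measurableM f g : bounded_measurable f -> bounded_measurable g ->
  bounded_measurable (fun t => f t * g t).
Proof.
move=> [mf [M fM]] [mg [N gN]]; split; first exact: measurable_funM.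
by exists (M * N) => t; rewrite normrM ler_pM.
Qed.

Lemma bounded_measurable_sum (I : Type) (s : seq I) (f : I -> T -> R) :
  (forall i, bounded_measurable (f i)) ->
  bounded_measurable (fun t => \sum_(i <- s) f i t).
Proof.
move=> bf; elim: s => [|i s ih].
  by under eq_fun do rewrite big_nil; exact: bounded_measurable_cst.
by under eq_fun do rewrite big_cons; exact: bounded_measurableD.
Qed.

Lemma bounded_measurable_indic (B : set T) : measurable B ->
  bounded_measurable (\1_B : T -> R).
Proof.
move=> mB; split; first exact: measurable_indic.
by exists 1 => t; rewrite indicE; case: (t \in B); rewrite ?normr1 ?normr0.
Qed.

End bounded_measurable.

Lemma bounded_measurable_comp (R : realType) (d d' : measure_display)
    (T : measurableType d) (T' : measurableType d') (X : T -> T') (f : T' -> R) :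
  measurable_fun setT X -> bounded_measurable f ->
  bounded_measurable (fun t => f (X t)).
Proof.
move=> mX [mf [M fM]]; split; last by exists M.
exact: (measurableT_comp mf mX).
Qed.

Section mean.
Context {R : realType} {d : measure_display} {T : measurableType d}
  (P : probability T R).
Implicit Types f g : T -> R.

Definition mean f : R := \int[P]_t f t.

Lemma bounded_measurable_integrable f : bounded_measurable f ->
  P.-integrable setT (EFin \o f).
Proof.
move=> [mf [M fM]]; apply: measurable_bounded_integrable => //.
  by rewrite [ltLHS]probability_setT ltry.
exists M; split; first exact: num_real.
by move=> x Mx t _; apply: (le_trans (fM t)); exact: ltW.
Qed.

Lemma expectation_mean f : bounded_measurable f -> ('E_P[f] = (mean f)%:E)%E.
Proof.
move=> bf; rewrite unlock /mean /Rintegral fineK //.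
exact: integrable_fin_num (bounded_measurable_integrable bf).
Qed.

Lemma mean_cst c : mean (fun=> c) = c.
Proof. by rewrite /mean Rintegral_cst // [X in fine X]probability_setT mulr1. Qed.

Lemma meanD f g : bounded_measurable f -> bounded_measurable g ->
  mean (fun t => f t + g t) = mean f + mean g.
Proof. by move=> bf bg; rewrite /mean RintegralD //; exact: bounded_measurable_integrable. Qed.

Lemma meanZ c f : bounded_measurable f -> mean (fun t => c * f t) = c * mean f.
Proof. by move=> bf; rewrite /mean RintegralZl //; exact: bounded_measurable_integrable. Qed.

Lemma mean_sum (I : Type) (s : seq I) (f : I -> T -> R) :
  (forall i, bounded_measurable (f i)) ->
  mean (fun t => \sum_(i <- s) f i t) = \sum_(i <- s) mean (f i).
Proof.
move=> bf; elim: s => [|i s ih].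
  by rewrite big_nil -[RHS]mean_cst; congr mean; apply/funext => t; rewrite big_nil.
rewrite big_cons -ih -meanD //; last exact: bounded_measurable_sum.
by congr mean; apply/funext => t; rewrite big_cons.
Qed.

Lemma le_mean f g : bounded_measurable f -> bounded_measurable g ->
  (forall t, f t <= g t) -> mean f <= mean g.
Proof.
by move=> bf bg fg; apply: le_Rintegral => //; exact: bounded_measurable_integrable.
Qed.

Lemma mean_indic (B : set T) : measurable B -> mean \1_B = fine (P B).
Proof. by move=> mB; rewrite /mean /Rintegral integral_indic // setIT. Qed.

Lemma bounded_convergence (h : nat -> T -> R) f M :
  (forall n, measurable_fun setT (h n)) -> (forall n t, `|h n t| <= M) ->
  (forall t, h ^~ t @ \oo --> f t) -> mean (h n) @[n --> \oo] --> mean f.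
Proof.
move=> mh hM hf.
have mf : measurable_fun setT f by exact: (measurable_fun_cvg mh).
have [] := @dominated_convergence _ T R P setT measurableT
  (fun n => EFin \o h n) (EFin \o f) (cst M%:E).
- by move=> n; exact/measurable_EFinP.
- exact/measurable_EFinP.
- by apply: aeW => t _; apply: cvg_EFin; [exact: nearW|exact: hf].
- exact: (bounded_measurable_integrable (bounded_measurable_cst M)).
- by apply: aeW => t n _; rewrite /= lee_fin.
by move=> /(integrable_fin_num measurableT)/fineK <- _ /fine_cvg.
Qed.

End mean.

Section product_rule.
Import HBNNSimple.
Context {R : realType} {d d' : measure_display} {T : measurableType d}
  {T' : measurableType d'} (P : probability T R) (D : probability T' R)
  (X : T -> T') (Y : T -> R).
Hypotheses (mX : measurable_fun setT X) (bY : bounded_measurable Y)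
  (XY : forall B, measurable B ->
    mean P (fun t => Y t * \1_B (X t)) = mean P Y * fine (D B)).

(** The factorisation holds for indicators by [XY]; it is extended to simple functions, then to
    nonnegative and finally to all bounded measurable functions. *)
Let product_rule g := mean P (fun t => Y t * g (X t)) = mean P Y * mean D g.

Lemma product_rule_sum (I : Type) (s : seq I) (g : I -> T' -> R) :
  (forall i, bounded_measurable (g i)) -> (forall i, product_rule (g i)) ->
  product_rule (fun x => \sum_(i <- s) g i x).
Proof.
move=> bg pg; rewrite /product_rule mean_sum // mulr_sumr.
rewrite -(eq_bigr _ (fun i _ => pg i)) -mean_sum => [|i].
  by congr mean; apply/funext => t; rewrite mulr_sumr.
by apply: bounded_measurableM => //; exact: bounded_measurable_comp.
Qed.

Lemma product_ruleZ c g : bounded_measurable g -> product_rule g ->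
  product_rule (fun x => c * g x).
Proof.
move=> bg pg; rewrite /product_rule meanZ // mulrCA -pg -meanZ.
  by congr mean; apply/funext => t; rewrite mulrCA.
by apply: bounded_measurableM => //; exact: bounded_measurable_comp.
Qed.

Lemma product_rule_nnsfun (h : {nnsfun T' >-> R}) : product_rule h.
Proof.
rewrite (_ : (h : T' -> R) =
    fun x => \sum_(y <- fset_set (range h)) y * \1_(h @^-1` [set y]) x); last first.
  by apply/funext => x; rewrite fimfunE fsbig_finite.
have mh y : measurable (h @^-1` [set y]) by exact: measurable_funPTI.
have bh y : bounded_measurable (\1_(h @^-1` [set y]) : T' -> R).
  exact: bounded_measurable_indic.
apply: product_rule_sum => y.
  by apply: bounded_measurableM => //; exact: bounded_measurable_cst.
by apply: product_ruleZ => //; rewrite /product_rule XY // mean_indic.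
Qed.

(** The increasing simple approximations of g share its bound, so bounded convergence applies to
    both sides of the rule. *)
Lemma product_rule_ge0 g : bounded_measurable g -> (forall x, 0 <= g x) ->
  product_rule g.
Proof.
move=> [mg [M gM]] g0.
have meg : measurable_fun setT (EFin \o g) by exact/measurable_EFinP.
pose h n : T' -> R := nnsfun_approx measurableT meg n.
have hg x : h ^~ x @ \oo --> g x.
  have := @cvg_nnsfun_approx _ _ _ _ measurableT _ meg (fun x _ => g0 x) x I.
  by move/fine_cvg.
have hM n x : `|h n x| <= M.
  rewrite ger0_norm; last exact: fun_ge0.
  apply: le_trans (gM x); apply: le_trans (ler_norm _).
  rewrite -(cvg_lim (@Rhausdorff R) (hg x)).
  apply: (@nondecreasing_cvgn_le _ (h ^~ x)); last by apply/cvg_ex; exists (g x).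
  by move=> p q pq; have /lefP := nd_nnsfun_approx measurableT meg pq; exact.
have mh n : measurable_fun setT (h n) by [].
have [mY [N YN]] := bY.
have lhs : mean P (fun t => Y t * h n (X t)) @[n --> \oo] -->
    mean P (fun t => Y t * g (X t)).
  apply: (@bounded_convergence _ _ _ P _ _ (N * M)) => [n|n t|t].
  - by apply: measurable_funM => //; exact: measurableT_comp.
  - by rewrite normrM ler_pM.
  - by apply: cvgM; [exact: cvg_cst|exact: hg].
have rhs : mean P (fun t => Y t * h n (X t)) @[n --> \oo] --> mean P Y * mean D g.
  under eq_fun do rewrite (product_rule_nnsfun (nnsfun_approx measurableT meg _)).
  by apply: cvgM; [exact: cvg_cst|exact: bounded_convergence hM hg].
by apply: cvg_unique lhs rhs => //; exact: Rhausdorff.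
Qed.

Lemma product_rule_bounded g : bounded_measurable g ->
  mean P (fun t => Y t * g (X t)) = mean P Y * mean D g.
Proof.
move=> bg; have [_ [M gM]] := bg.
(* Adding the bound M makes g nonnegative; the extra term M times the mean of Y cancels at the
   end. *)
have bM : bounded_measurable (fun x => g x + M).
  by apply: bounded_measurableD => //; exact: bounded_measurable_cst.
have := product_rule_ge0 bM (fun x => _); rewrite /product_rule.
rewrite meanD //; last exact: bounded_measurable_cst.
rewrite mean_cst (_ : (fun t => _) = fun t => Y t * g (X t) + M * Y t); last first.
  by apply/funext => t; rewrite mulrDr (mulrC M).
rewrite meanD ?meanZ //; first last.
- by apply: bounded_measurableM => //; exact: bounded_measurable_cst.
- by apply: bounded_measurableM => //; exact: bounded_measurable_comp.
rewrite mulrDr (mulrC M) => h; apply: (@addIr _ (mean P Y * M)); apply: h => x.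
by have := gM x; rewrite ler_norml => /andP[h _]; rewrite -lerBlDr sub0r.
Qed.

End product_rule.

(** * Independence of the current sketch from the past *)

Section independence.
Context {R : realType} {d d' : measure_display} {Omega : measurableType d}
  {T : measurableType d'} (P : probability Omega R) (D : probability T R)
  (S : nat -> {mfun Omega >-> T}).
Hypotheses (S_law : forall k (B : set T), measurable B -> distribution P (S k) B = D B)
  (S_indep : mutually_independent P (fun k => S k : Omega -> T)).

Let event (J : {fset nat}) (B : nat -> set T) :=
  \bigcap_(j in [set` J]) (S j @^-1` B j).

(* Meant for functions Y of S 0, ..., S (l-1): independence from the later sketches is
   tested on finite intersections of events only, which is what makes the property
   stable under sums. *)
Definition independent_from (l : nat) (Y : Omega -> R) :=
  bounded_measurable Y /\
  forall (J : {fset nat}) (B : nat -> set T), (forall j, measurable (B j)) ->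
    (forall j, j \in J -> (l <= j)%N) ->
    mean P (fun w => Y w * \1_(event J B) w) =
    mean P Y * \prod_(j <- J) fine (D (B j)).

Let measurable_event J B : (forall j, measurable (B j)) -> measurable (event J B).
Proof.
move=> mB; apply: fin_bigcap_measurable => // j _.
by rewrite -[X in measurable X]setTI; exact: measurable_funP.
Qed.

(** Base of the induction: a constant leaves only the probability of the event, which mutual
    independence and the common law turn into a product. *)
Lemma independent_from_cst c : independent_from 0 (fun=> c).
Proof.
split=> [|J B mB _]; first exact: bounded_measurable_cst.
rewrite meanZ; last exact/bounded_measurable_indic/measurable_event.
rewrite mean_cst mean_indic; last exact: measurable_event.
congr (_ * _); rewrite S_indep //.
transitivity (fine (\prod_(j <- J) fine (D (B j)))%:E) => //; congr fine.
elim/big_ind2 : _ => // [x1 x2 y1 y2 -> ->|j _]; first by rewrite EFinM.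
rewrite fineK; last exact: fin_num_measure.
by rewrite -(S_law j).
Qed.

Lemma independent_from_sum (l : nat) (I : Type) (s : seq I) (Y : I -> Omega -> R) :
  (forall i, independent_from l (Y i)) ->
  independent_from l (fun w => \sum_(i <- s) Y i w).
Proof.
move=> iY; have bY i : bounded_measurable (Y i) by have [] := iY i.
split=> [|J B mB lJ]; first exact: bounded_measurable_sum.
rewrite mean_sum // mulr_suml.
rewrite -(eq_bigr _ (fun i _ => (iY i).2 J B mB lJ)) -mean_sum => [|i].
  by congr mean; apply/funext => w; rewrite mulr_suml.
by apply: bounded_measurableM => //; exact/bounded_measurable_indic/measurable_event.
Qed.

(** The product rule with X = S_l and with the indicator of the later event absorbed into Y. Its
    hypothesis on indicators holds because a condition on S_l merely adds the index l to the
    event. *)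
Let split_rule l Y J B g : independent_from l Y -> (forall j, measurable (B j)) ->
  (forall j, j \in J -> (l < j)%N) -> bounded_measurable g ->
  mean P (fun w => Y w * \1_(event J B) w * g (S l w)) =
  mean P Y * \prod_(j <- J) fine (D (B j)) * mean D g.
Proof.
move=> [bY iY] mB lJ bg.
have lJ' j : j \in J -> (l <= j)%N by move/lJ/ltnW.
rewrite -(iY J B mB lJ').
apply: product_rule_bounded => //.
  by apply: bounded_measurableM => //; exact/bounded_measurable_indic/measurable_event.
(* [B'] prescribes C at l and agrees with B on J, which does not contain l. *)
move=> C mC; pose B' j := if j == l then C else B j.
have lNJ : l \notin J by apply/negP => /lJ; rewrite ltnn.
have BB' j : j \in J -> B' j = B j.
  by move=> jJ; rewrite /B' ifN //; apply: contraNneq lNJ => <-.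
have mB' j : measurable (B' j) by rewrite /B'; case: ifP.
have lJ1 j : j \in (l |` J)%fset -> (l <= j)%N by move=> /fset1UP[->//|/lJ'].
have B'l : B' l = C by rewrite /B' eqxx.
have := iY _ B' mB' lJ1; rewrite big_fsetU1 //= B'l.
rewrite (eq_big_seq (fun j => fine (D (B j)))) => [|j jJ]; last by rewrite BB'.
move=> e1; rewrite (iY J B mB lJ') -mulrA [_ * fine (D C)]mulrC -e1.
congr mean; apply/funext => w; rewrite /= -mulrA; congr (_ * _).
rewrite /event bigcap_fsetU1 indicI /= B'l mulrC; congr (_ * _).
congr (\1_ _ w); apply: eq_bigcapr => j jJ; by rewrite BB'.
Qed.

Lemma independent_from_mean l Y g : independent_from l Y -> bounded_measurable g ->
  mean P (fun w => Y w * g (S l w)) = mean P Y * mean D g.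
Proof.
move=> iY bg; rewrite -[mean P Y]mulr1.
have := @split_rule l Y fset0 (fun=> setT) g iY (fun=> measurableT) _ bg.
rewrite big_seq_fset0 => <- //; congr mean; apply/funext => w.
by rewrite /event set_fset0 bigcap_set0 indicT mulr1.
Qed.

(** Using up S_l raises the index by one; this is what carries independence along the iteration. *)
Lemma independent_from_mul l Y g : independent_from l Y -> bounded_measurable g ->
  independent_from l.+1 (fun w => Y w * g (S l w)).
Proof.
move=> iY bg; split=> [|J B mB lJ].
  by apply: bounded_measurableM; [case: iY|exact: bounded_measurable_comp].
rewrite (independent_from_mean iY bg) mulrAC -(split_rule iY mB lJ bg).
by congr mean; apply/funext => w; rewrite mulrAC.
Qed.

End independence.

(** * Contraction of the mean square error *)

Section expected_projection.
Context {R : realType} {m n : nat} (A : 'M[R]_(m, n)) (D : probability (sketch R m) R).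
Implicit Types u v : 'cV[R]_n.

Lemma bounded_measurable_sketchZ i j :
  bounded_measurable (fun S : sketch R m => sketchZ A S i j).
Proof.
split; first exact: measurable_sketchZ.
by exists 1 => S; exact: proj_coord_le1 (sketchZ_proj A S) i j.
Qed.

Lemma WmxE i j : Wmx A D i j = mean D (fun S => sketchZ A S i j).
Proof. by rewrite mxE expectation_mean //; exact: bounded_measurable_sketchZ. Qed.

Lemma bounded_measurable_dot_sketchZ u :
  bounded_measurable (fun S : sketch R m => dot u (sketchZ A S *m u)).
Proof.
under eq_fun do rewrite dot_sum2.
do 2 apply: bounded_measurable_sum => ?; apply: bounded_measurableM.
  exact: bounded_measurable_cst.
exact: bounded_measurable_sketchZ.
Qed.

Lemma dot_Wmx u : dot u (Wmx A D *m u) = mean D (fun S => dot u (sketchZ A S *m u)).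
Proof.
under [X in mean D X]eq_fun do rewrite dot_sum2.
have bZ i j : bounded_measurable (fun S => u i 0 * u j 0 * sketchZ A S i j).
  apply: bounded_measurableM; first exact: bounded_measurable_cst.
  exact: bounded_measurable_sketchZ.
rewrite mean_sum => [|i]; last exact: bounded_measurable_sum.
rewrite dot_sum2; apply: eq_bigr => i _; rewrite mean_sum //.
apply: eq_bigr => j _; rewrite WmxE meanZ //.
exact: bounded_measurable_sketchZ.
Qed.

Lemma Wmx_sym : (Wmx A D)^T = Wmx A D.
Proof.
apply/matrixP => i j; rewrite mxE !WmxE; congr mean; apply/funext => S.
by rewrite -{1}(sketchZ_proj A S).1 [LHS]mxE.
Qed.

Lemma Wmx_psd u : 0 <= dot u (Wmx A D *m u).
Proof.
rewrite dot_Wmx -[X in X <= _](mean_cst D); apply: le_mean.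
- exact: bounded_measurable_cst.
- exact: bounded_measurable_dot_sketchZ.
- by move=> S; exact: dot_proj_ge0 (sketchZ_proj A S) u.
Qed.

Lemma Wmx_le1 u : dot u (Wmx A D *m u) <= dot u u.
Proof.
rewrite dot_Wmx -[X in _ <= X](mean_cst D); apply: le_mean.
- exact: bounded_measurable_dot_sketchZ.
- exact: bounded_measurable_cst.
- by move=> S; exact: dot_proj_le (sketchZ_proj A S) u.
Qed.

Lemma fobj_Wmx (b : 'cV[R]_m) (c x : 'cV[R]_n) : A *m c = b ->
  fobj A b D x = (2^-1 * dot (x - c) (Wmx A D *m (x - c)))%:E.
Proof.
move=> Ac; rewrite dot_Wmx -meanZ; last exact: bounded_measurable_dot_sketchZ.
rewrite -expectation_mean; last first.
  apply: bounded_measurableM; first exact: bounded_measurable_cst.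
  exact: bounded_measurable_dot_sketchZ.
by rewrite /fobj; congr expectation; apply/funext => S; rewrite (fS_quadratic _ Ac).
Qed.

(** Moving from a solution c along the kernel of W keeps the objective at 0, its minimum, so c + v
    is again a minimiser and, by exactness, a solution. *)
Lemma ker_Wmx (b : 'cV[R]_m) (c v : 'cV[R]_n) : solutions A b c ->
  minimizers (fobj A b D) = solutions A b -> Wmx A D *m v = 0 -> A *m v = 0.
Proof.
move=> Ac exactness Wv.
have : solutions A b (c + v).
  rewrite -exactness => y; rewrite !(fobj_Wmx _ Ac) lee_fin addrAC subrr add0r.
  by rewrite Wv dot0r mulr0 mulr_ge0 // Wmx_psd.
by rewrite /solutions /= mulmxDr Ac => /eqP; rewrite -subr_eq0 addrAC subrr add0r => /eqP.
Qed.

End expected_projection.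

(** * The error along the iteration *)

Section convergence.
Context {R : realType} {m n : nat} (A : 'M[R]_(m, n)) (b : 'cV[R]_m)
  (D : probability (sketch R m) R) (x0 xstar : 'cV[R]_n)
  {d : measure_display} {Omega : measurableType d} (P : probability Omega R)
  (S : nat -> {mfun Omega >-> sketch R m}).
Hypotheses (exactness : minimizers (fobj A b D) = solutions A b)
  (xstar_proj : is_projection (solutions A b) x0 xstar)
  (S_law : forall (k : nat) (B : set (sketch R m)),
      measurable B -> distribution P (S k) B = D B)
  (S_indep : mutually_independent P (fun k => S k : Omega -> sketch R m)).

Let W := Wmx A D.
Let e k w := sgd A b x0 (fun j => S j w) k - xstar.

Let Axstar : A *m xstar = b. Proof. by case: xstar_proj. Qed.

Let e_succ k w : e k.+1 w = e k w - sketchZ A (S k w) *m e k w.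
Proof. exact: sgd_error. Qed.

(** A kernel vector of W lies in the kernel of A. The initial error is orthogonal to it by the
    projection property, and each step subtracts Z e_k, orthogonal to it because Z is symmetric and
    kills it. *)
Lemma error_perp_ker k w v : W *m v = 0 -> dot (e k w) v = 0.
Proof.
move=> /(ker_Wmx xstar_proj.1 exactness) Av.
elim: k => [|k ih]; first exact: projection_orthogonal xstar_proj Av.
rewrite e_succ dotDl dotNl ih dotC dot_mulmx (sketchZ_proj A (S k w)).1.
by rewrite sketchZ_ker // dot0l subrr.
Qed.

(** Products of two coordinates form a closed system: those of e_{k+1} are sums of those of e_k
    times functions of S_k alone. *)
Let independent_error k i j :
  independent_from P D S k (fun w => e k w i 0 * e k w j 0).
Proof.
elim: k i j => [|k ih] i j; first exact: (independent_from_cst S_law S_indep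
  ((x0 - xstar) i 0 * (x0 - xstar) j 0)).
pose T (s : sketch R m) := 1%:M - sketchZ A s.
have bT a c : bounded_measurable (fun s => T s a c).
  rewrite (_ : (fun s => _) = fun s => 1%:M a c + -1 * sketchZ A s a c); last first.
    by apply/funext => s; rewrite mxE [X in _ + X]mxE mulN1r.
  apply: bounded_measurableD; first exact: bounded_measurable_cst.
  apply: bounded_measurableM; first exact: bounded_measurable_cst.
  exact: bounded_measurable_sketchZ.
rewrite (_ : (fun w => _) = fun w => \sum_a \sum_c
    (e k w a 0 * e k w c 0) * (T (S k w) i a * T (S k w) j c)); last first.
  apply/funext => w.
  have eT : e k.+1 w = T (S k w) *m e k w by rewrite e_succ mulmxBl mul1mx.
  rewrite eT !mxE mulr_suml; apply: eq_bigr => a _.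
  by rewrite mulr_sumr; apply: eq_bigr => c _; ring.
do 2 apply: independent_from_sum => ?.
by apply: (independent_from_mul (g := fun s => T s i _ * T s j _)) => //;
  exact: bounded_measurableM.
Qed.

Let bounded_error2 k : bounded_measurable (fun w => dot (e k w) (e k w)).
Proof. by apply: bounded_measurable_sum => i; case: (independent_error k i i). Qed.

Let bounded_error_quad k (Z : Omega -> 'M[R]_n) :
  (forall i j, bounded_measurable (fun w => Z w i j)) ->
  bounded_measurable (fun w => dot (e k w) (Z w *m e k w)).
Proof.
move=> bZ; under eq_fun do rewrite dot_sum2.
apply: bounded_measurable_sum => i; apply: bounded_measurable_sum => j.
exact: bounded_measurableM (independent_error k i j).1 (bZ i j).
Qed.

Let bounded_Z k i j : bounded_measurable (fun w => sketchZ A (S k w) i j).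
Proof.
by apply: (bounded_measurable_comp (f := fun s => sketchZ A s i j)) => //;
  exact: bounded_measurable_sketchZ.
Qed.

(** In coordinates, independence lets each entry of Z_{S_k} be replaced by its mean, the entry of
    W. *)
Lemma mean_error_quad k :
  mean P (fun w => dot (e k w) (sketchZ A (S k w) *m e k w)) =
  mean P (fun w => dot (e k w) (W *m e k w)).
Proof.
have bee i j := (independent_error k i j).1.
under eq_fun do rewrite dot_sum2.
under [in RHS]eq_fun do rewrite dot_sum2.
have bZ := bounded_Z k.
have b1 i j := bounded_measurableM (bee i j) (bZ i j).
have b2 i j := bounded_measurableM (bee i j) (bounded_measurable_cst (W i j)).
rewrite !mean_sum => [|i|i]; try exact: bounded_measurable_sum.
apply: eq_bigr => i _; rewrite !mean_sum //; apply: eq_bigr => j _.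
rewrite (independent_from_mean (independent_error k i j)
  (bounded_measurable_sketchZ A i j)) -WmxE mulrC -meanZ //.
by congr mean; apply/funext => w; rewrite mulrC.
Qed.

Lemma mean_error_step k :
  mean P (fun w => dot (e k.+1 w) (e k.+1 w)) <=
  (1 - lambda_min_pos W) * mean P (fun w => dot (e k w) (e k w)).
Proof.
have bquad : bounded_measurable (fun w => dot (e k w) (W *m e k w)).
  by apply: bounded_error_quad => i j; exact: bounded_measurable_cst.
have bZ : bounded_measurable (fun w => dot (e k w) (sketchZ A (S k w) *m e k w)).
  by apply: bounded_error_quad; exact: bounded_Z.
have -> : mean P (fun w => dot (e k.+1 w) (e k.+1 w)) =
    mean P (fun w => dot (e k w) (e k w)) - mean P (fun w => dot (e k w) (W *m e k w)).
  rewrite -mean_error_quad -mulN1r -meanZ // -meanD //; last first.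
    by apply: bounded_measurableM => //; exact: bounded_measurable_cst.
  congr mean; apply/funext => w.
  by rewrite mulN1r e_succ (dot_projB (sketchZ_proj A (S k w))).
rewrite mulrBl mul1r lerD2l lerN2 -meanZ //; apply: le_mean => //.
  by apply: bounded_measurableM => //; exact: bounded_measurable_cst.
move=> w; apply: lambda_min_pos_rayleigh.
- exact: Wmx_sym.
- exact: Wmx_psd.
- by move=> v; exact: error_perp_ker.
Qed.

Lemma mean_error_le k : mean P (fun w => dot (e k w) (e k w)) <=
  (1 - lambda_min_pos W) ^+ k * dot (x0 - xstar) (x0 - xstar).
Proof.
elim: k => [|k ih]; first by rewrite /e /= mean_cst mul1r.
apply: le_trans (mean_error_step k) _; rewrite exprS -mulrA.
(* Multiplying the induction hypothesis by 1 - lambda needs lambda <= 1. *)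
apply: ler_wpM2l ih; rewrite subr_ge0.
apply: lambda_min_pos_le1; [exact: Wmx_sym|exact: Wmx_psd|exact: Wmx_le1].
Qed.

Lemma expectation_error_le k :
  ('E_P[fun w => (enorm (sgd A b x0 (fun j => S j w) k - xstar) ^+ 2)%R]
   <= ((1 - lambda_min_pos W) ^+ k * enorm (x0 - xstar) ^+ 2)%:E)%E.
Proof.
under eq_fun do rewrite enorm_sqr.
by rewrite enorm_sqr (expectation_mean P (bounded_error2 k)) lee_fin mean_error_le.
Qed.

End convergence.

Theorem theoremB3 (R : realType) (m n : nat) (A : 'M[R]_(m, n)) (b : 'cV[R]_m)
    (A_neq0 : A != 0)
    (consistent : exists x, solutions A b x)
    (D : probability (sketch R m) R)
    (exactness : minimizers (fobj A b D) = solutions A b)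
    (x0 xstar : 'cV[R]_n)
    (xstar_proj : is_projection (solutions A b) x0 xstar)
    (d : measure_display) (Omega : measurableType d) (P : probability Omega R)
    (S : nat -> {mfun Omega >-> sketch R m})
    (S_law : forall (k : nat) (B : set (sketch R m)),
      measurable B -> distribution P (S k) B = D B)
    (S_indep : mutually_independent P (fun k => S k : Omega -> sketch R m))
    (k : nat) :
  ('E_P[fun w => (enorm (sgd A b x0 (fun j => S j w) k - xstar) ^+ 2)%R]
   <= ((1 - lambda_min_pos (Wmx A D)) ^+ k * enorm (x0 - xstar) ^+ 2)%:E)%E.
Proof. exact: expectation_error_le. Qed.
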